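(* Let $\Gamma$ be an infinite set. Then $c_0(\Gamma)$ (with the supremum norm) does not admit any star-finite covering by closed balls, and it fails property $(\mathcal I_{\aleph_0})$.
   Context: $c_0(\Gamma)$ is the real Banach space of real functions on $\Gamma$ vanishing at infinity. Closed balls have positive radius. A covering of $X$ is a family of nonempty subsets of $X$ whose union is $X$. A family of sets is star-finite if each of its members intersects only finitely many other members. For a normed space $X$ with closed unit ball $B_X$ and unit sphere $S_X$, a cardinal $\alpha$ and $\epsilon>0$, a point $x\in S_X$ has property $(\mathcal I_{\alpha,\epsilon})$ if, whenever $\mathcal B$ is a family of pairwise disjoint closed balls of radius $1$ not intersecting $B_X$ and such that $|\mathcal B|=\alpha$, one has $\sup_{B\in\mathcal B}\mathrm{dist}(x,B)>\epsilon$. The space $X$ has property $(\mathcal I_\alpha)$ if for each $x\in S_X$ there exists $\epsilon>0$ such that $x$ has property $(\mathcal I_{\alpha,\epsilon})$. *)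

(* Defs.v *)
From HB Require Import structures.
From mathcomp Require Import all_boot all_order all_algebra.
From mathcomp Require Import all_classical all_reals all_analysis.
From mathcomp Require Import lra.

Set Implicit Arguments.
Unset Strict Implicit.
Unset Printing Implicit Defensive.

Import Order.TTheory GRing.Theory Num.Theory.
Import numFieldNormedType.Exports.

Local Open Scope classical_set_scope.
Local Open Scope ring_scope.

Section c0_space.
Variables (R : realType) (Gamma : Type).

Definition vanishing : set (Gamma -> R) :=
  [set f | forall e, 0 < e -> finite_set [set g | e <= `|f g|]].

Definition vanishing_pred : {pred Gamma -> R} := mem vanishing.

Lemma vanishingP (f : Gamma -> R) :
  (f \in vanishing_pred) <-> (forall e, 0 < e -> finite_set [set g | e <= `|f g|]).
Proof. by split=> [/set_mem//|f0]; apply: (@mem_set _ vanishing). Qed.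

Lemma vanishing_submod : submod_closed vanishing_pred.
Proof.
split=> [|a f h /vanishingP f0 /vanishingP h0]; apply/vanishingP => e e0.
  rewrite (_ : [set _ | _] = set0)//; apply/seteqP; split=> // g /=.
  by rewrite normr0 leNgt e0.
have a1 : 0 < `|a| + 1 by rewrite ltr_wpDl.
have e1 : 0 < e / 2 / (`|a| + 1) by rewrite !divr_gt0.
have e2 : 0 < e / 2 by rewrite divr_gt0.
apply: (@sub_finite_set _ _
  ([set g | e / 2 / (`|a| + 1) <= `|f g|] `|` [set g | e / 2 <= `|h g|])); last first.
  by rewrite finite_setU; split; [exact: f0|exact: h0].
move=> g /= eg; case: (leP (e / 2) `|h g|) => hg; first by right.
left; rewrite ler_pdivrMr// leNgt; apply/negP => fg.
move: eg; rewrite leNgt => /negP; apply.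
rewrite (le_lt_trans (ler_normD _ _))// [e]splitr ltrD//.
rewrite normrM (le_lt_trans _ fg)// mulrC ler_wpM2l//.
by rewrite lerDl.
Qed.

HB.instance Definition _ :=
  GRing.isSubmodClosed.Build R (Gamma -> R) vanishing_pred vanishing_submod.

Record c0 := C0 { c0_fun :> Gamma -> R; _ : c0_fun \in vanishing_pred }.

HB.instance Definition _ := [isSub for c0_fun].
HB.instance Definition _ := [Choice of c0 by <:].
HB.instance Definition _ := [SubChoice_isSubLmodule of c0 by <:].

Lemma c0P (f : c0) e : 0 < e -> finite_set [set g | e <= `|f g|].
Proof. by case: f => f /= /vanishingP; exact. Qed.

Lemma c0_eqP (f h : c0) : (forall g, f g = h g) -> f = h.
Proof. by move=> fh; apply/val_inj/funext. Qed.

Definition c0_norm (f : c0) : R := sup [set `|f g| | g in [set: Gamma]].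

Lemma c0_has_ubound (f : c0) : has_ubound [set `|f g| | g in [set: Gamma]].
Proof.
have := finite_image (fun g => `|f g|) (c0P f ltr01).
move=> /finite_seqP[s fs].
exists (1 + \sum_(y <- s) `|y|) => _ [g _ <-].
case: (leP 1 `|f g|) => fg; last first.
  by rewrite (le_trans (ltW fg))// lerDl sumr_ge0.
have : `|f g| \in s.
  by have : [set` s] `|f g| by rewrite -fs; exists g.
move=> /(big_rem _) => /(_ _ _ _ xpredT (fun y => `|y|)) ->.
by rewrite normr_id addrCA lerDl addr_ge0// sumr_ge0.
Qed.

Lemma c0_le_norm (f : c0) g : `|f g| <= c0_norm f.
Proof. by apply: ub_le_sup; [exact: c0_has_ubound|exists g]. Qed.

Lemma c0_norm_le (f : c0) r : 0 <= r -> (forall g, `|f g| <= r) -> c0_norm f <= r.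
Proof.
move=> r0 fr; rewrite /c0_norm.
have [->|/set0P ne] := eqVneq [set `|f g| | g in [set: Gamma]] set0.
  by rewrite sup0.
by apply: ge_sup => // _ [g _ <-].
Qed.

Lemma c0_norm_ge0 f : 0 <= c0_norm f.
Proof.
rewrite /c0_norm.
have [->|/set0P[_ [g _ _]]] := eqVneq [set `|f g| | g in [set: Gamma]] set0.
  by rewrite sup0.
exact: le_trans (c0_le_norm f g).
Qed.

Lemma c0_ler_normD f h : c0_norm (f + h) <= c0_norm f + c0_norm h.
Proof.
apply: c0_norm_le => [|g]; first by rewrite addr_ge0 ?c0_norm_ge0.
by rewrite (le_trans (ler_normD _ _))// lerD ?c0_le_norm.
Qed.

Lemma c0_normrZ a f : c0_norm (a *: f) = `|a| * c0_norm f.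
Proof.
have le b h : c0_norm (b *: h) <= `|b| * c0_norm h.
  apply: c0_norm_le => [|g]; first by rewrite mulr_ge0 ?c0_norm_ge0.
  by rewrite normrM ler_wpM2l// c0_le_norm.
apply/eqP; rewrite eq_le le/=.
have [->|a0] := eqVneq a 0; first by rewrite normr0 mul0r c0_norm_ge0.
rewrite -ler_pdivlMl ?normr_gt0//.
by rewrite -[in leLHS](scalerK a0 f) (le_trans (le _ _))// normfV.
Qed.

Lemma c0_normr0_eq0 f : c0_norm f = 0 -> f = 0.
Proof.
move=> f0; apply: c0_eqP => g; apply/eqP.
by rewrite -normr_le0 -f0 c0_le_norm.
Qed.

HB.instance Definition _ :=
  @Lmodule_isNormed.Build R c0 c0_norm c0_ler_normD c0_normrZ c0_normr0_eq0.

Lemma c0_normE (f : c0) : `|f| = sup [set `|f g| | g in [set: Gamma]].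
Proof. by []. Qed.

Lemma c0_complete (F : set_system c0) :
  ProperFilter F -> cauchy F -> cvg F.
Proof.
move=> FF /cauchy_ballP Fc.
have ball_dist (a b : c0) e : ball a e b -> forall g, `|a g - b g| < e.
  by rewrite -ball_normE /= => ab g; exact: le_lt_trans (c0_le_norm (a - b) g) ab.
have fcvg g : cvg ((fun f : c0 => f g) @ F).
  apply: cauchy_cvg; apply/cauchy_ballP => e e0.
  have [/= A [A1 A2] Ae] := Fc e e0.
  exists ((fun f : c0 => f g) @` A.1, (fun f : c0 => f g) @` A.2) => /=.
    by split; [apply: filterS A1|apply: filterS A2] => f Af; exists f.
  move=> [_ _] /= [[a Aa <-] [b Ab <-]].
  by rewrite -ball_normE /=; apply: ball_dist; exact: (Ae (a, b)).
pose l g := lim ((fun f : c0 => f g) @ F).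
have close e : 0 < e -> \forall f \near F, forall g, `|(f : c0) g - l g| <= e.
  move=> e0; have [/= A [A1 A2] Ae] := Fc e e0.
  apply: filterS A1 => a Aa g.
  apply: (@closed_cvg _ _ F FF (fun f : c0 => f g) (closed_ball_ Num.norm (a g : R) e)).
  - exact: closed_closed_ball_.
  - by apply: filterS A2 => b Ab; apply/ltW/ball_dist; exact: (Ae (a, b)).
  - exact: fcvg.
have l0 : l \in vanishing_pred.
  apply/vanishingP => e e0; have e2 : 0 < e / 2 by rewrite divr_gt0.
  have [f fl] := filter_ex (close _ e2).
  apply: sub_finite_set (c0P f e2) => g /= eg.
  move: (fl g) => /= flg; have := ler_normD (f g) (l g - f g).
  by rewrite addrC subrK distrC => /(le_trans eg); lra.
suff : F --> (C0 l0 : c0) by move=> Fl; apply/cvg_ex; exists (C0 l0).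
apply/cvg_ballP => e e0; have e2 : 0 < e / 2 by rewrite divr_gt0.
apply: filterS (close _ e2) => f fl.
rewrite -ball_normE /=; apply: (@le_lt_trans _ _ (e / 2)).
  by apply: c0_norm_le; [exact: ltW|move=> g /=; rewrite distrC; exact: fl].
by rewrite ltr_pdivrMr// ltr_pMr// ltr1n.
Qed.

HB.instance Definition _ := Uniform_isComplete.Build c0 c0_complete.

End c0_space.

Section covering.
Variables (R : realType) (X : normedModType R).

Definition is_covering (F : set (set X)) : Prop :=
  (forall B, F B -> B !=set0) /\ \bigcup_(B in F) B = [set: X].

Definition star_finite (F : set (set X)) : Prop :=
  forall B, F B -> finite_set [set C | [/\ F C, C <> B & B `&` C !=set0]].

(* closed_ball x r is by definition the closure of the open ball; for r > 0 it is
   [set y | `|x - y| <= r], see closed_ballE. *)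
Definition closed_balls : set (set X) :=
  [set B | exists x : X, exists2 r : R, 0 < r & B = closed_ball x r].

Definition unit_ball : set X := closed_ball (0 : X) 1.

Definition unit_sphere : set X := [set x | `|x| = 1].

Lemma edist_norm (x y : X) : edist (x, y) = `|x - y|%:E.
Proof.
apply/eqP; rewrite eq_le; apply/andP; split; last first.
  apply: le_ereal_inf_tmp => _ [r [r0 /= + <-]].
  by rewrite -ball_normE /= lee_fin => /ltW.
apply/lee_addgt0Pr => e e0; rewrite -EFinD; apply: edist_fin => /=.
  by rewrite ltr_wpDl.
by rewrite -ball_normE /= ltrDl.
Qed.

(* A cardinal is presented by a type K of that cardinality. Since balls are
   nonempty, members of a pairwise disjoint family are distinct, so such a family
   is the same thing as a set of balls. edist_inf B x is dist(x, B), and the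
   supremum is taken in \bar R because the distances need not be bounded. *)
Definition property_I_at (K : Type) (e : R) (x : X) : Prop :=
  forall F : set (set X),
    (forall B, F B -> exists c : X, B = closed_ball c 1) ->
    (forall B, F B -> B `&` unit_ball = set0) ->
    trivIset F id ->
    (F #= [set: K])%card ->
    (e%:E < ereal_sup [set edist_inf B x | B in F])%E.

Definition property_I (K : Type) : Prop :=
  forall x : X, unit_sphere x -> exists2 e : R, 0 < e & property_I_at K e x.

End covering.

Arguments closed_balls {R} X.
Arguments property_I {R} X K.

(* Main.v *)
Require Import Defs.
From mathcomp Require Import all_boot all_order all_algebra.
From mathcomp Require Import all_classical all_reals all_analysis.
From mathcomp Require Import ring lra.

Set Implicit Arguments.
Unset Strict Implicit.
Unset Printing Implicit Defensive.

Import numFieldNormedType.Exports.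
Import Order.TTheory GRing.Theory Num.Theory.
Local Open Scope classical_set_scope.
Local Open Scope ring_scope.

(** Closed balls of c_0 are boxes: membership is tested coordinate by
    coordinate. Restricting a covering of c_0(Gamma) to the vectors supported
    on a countable infinite set of coordinates turns each ball into a ball or
    into the empty set and preserves star-finiteness, so it is enough to treat
    c_0(nat), which is separable; there the family is countable.

    Call a point fat if, near it, every point lies in a ball of the family of
    radius bounded below, and thin otherwise. Three facts exclude star-finite
    coverings.

    - [fat_star]: a fat point x shares a ball of the family with each nearby
      point z. The point z may be replaced by the vector equal to z in the first
      N coordinates and to x afterwards. A ball of radius at least r that
      contains it also contains one of the 2^N vectors obtained from x by moving
      the first N coordinates by r/2 or -r/2. By point-finiteness only finitely
      many balls occur, and those that miss x are at positive distance from x.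

    - [fat_ball_not_maximal]: if all points of a ball C of the family are fat,
      then C is covered by strictly larger balls of the family. If z in C were
      in no larger ball, one could choose a new coordinate for each of the
      finitely many balls touching C and move z in these coordinates onto faces
      of C, each time on the side away from the centre of the corresponding
      ball. The vector obtained is fat, yet a point slightly further out in
      these coordinates is in no ball touching C, against [fat_star].

    - Hence a ball of maximal radius among those through a given point always
      contains a thin point ([max_ball_thin]), so thin points exist. They form a
      closed set covered by countably many balls; by Baire's theorem, near some
      thin point x all thin points lie in a single ball B. A small ball that is
      maximal at a point near x stays near x and contains a thin point, hence
      touches B. Only finitely many balls do, so the radii of the maximal balls
      near x are bounded below: x is fat, a contradiction.

    For the failure of the property, let x be the unit vector e_0. The unit balls
    centred at (2 + e) e_0 - (1 + e) (e_1 + ... + e_n) + (1 + e) e_(n+1) are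
    within e of x, miss the unit ball because of coordinate 0, and are pairwise
    disjoint because of the sign change in coordinate n + 1. *)

(** * Finite sets and Baire's theorem on a closed subset *)

Section general.

Lemma near_finite (T U : Type) (G : set_system U) (A : set T)
    (P : T -> U -> Prop) : Filter G -> finite_set A ->
  (forall t, A t -> \forall u \near G, P t u) ->
  \forall u \near G, forall t, A t -> P t u.
Proof.
move=> FG /finite_setP[n]; elim: n => [|n IH] in A *.
  by rewrite II0 card_eq0 => /eqP -> _; apply: nearW.
move=> /eq_cardSP[t At An] AP.
have Pt := AP t At.
have := IH _ An (fun s As => AP s As.1).
move=> Ps; apply: (@filterS2 _ _ FG _ _ _ _ Pt Ps) => u Ptu Psu s As.
by have [->//|/eqP st] := eqVneq (s : {classic T}) t; apply: Psu.
Qed.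

(** The usual nested balls, centred at points of D: if no B n contained a
    relatively open part of D, each step could avoid one more B n, and the
    limit of the centres would be a point of D outside all of them. *)
Lemma baire_closed (R : realType) (X : completeNormedModType R) (D : set X)
    (B : nat -> set X) :
  closed D -> D !=set0 -> (forall n, closed (B n)) -> D `<=` \bigcup_n B n ->
  exists n x e, [/\ D x, 0 < e & ball x e `&` D `<=` B n].
Proof.
move=> cD [x0 Dx0] cB DB; apply: contrapT => noB.
have step (p : nat * (X * R)) : exists q : X * R,
    D p.2.1 -> 0 < p.2.2 ->
    [/\ D q.1, 0 < q.2, q.2 <= p.2.2 / 2,
      closed_ball q.1 q.2 `<=` ball p.2.1 p.2.2 &
      closed_ball q.1 q.2 `<=` ~` B p.1].
  case: p => n [x e] /=.
  have [[Dx e0]|/not_andP h] := pselect (D x /\ 0 < e); last first.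
    by exists (x, e) => ? ?; case: h.
  have [y [xy Dy nBy]] : exists y, [/\ ball x e y, D y & ~ B n y].
    apply: contrapT => h; apply: noB; exists n, x, e; split=> // y [xy Dy].
    by apply: contrapT => nBy; apply: h; exists y.
  have : nbhs y (ball x e `&` ~` B n).
    apply: open_nbhs_nbhs; split=> //; apply: openI; first exact: ball_open.
    exact/closed_openC/cB.
  move=> /nbhs_closedballP[d dB].
  have m0 : 0 < Num.min d%:num (e / 2) by rewrite lt_min divr_gt0// andbT.
  have sub : closed_ball y (Num.min d%:num (e / 2)) `<=` ball x e `&` ~` B n.
    by apply: subset_trans dB; apply: le_closed_ball; rewrite ge_min lexx.
  exists (y, Num.min d%:num (e / 2)) => /= _ _; split=> //.
  - by rewrite ge_min lexx orbT.
  - by move=> z /sub[].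
  - by move=> z /sub[].
have [f fP] := choice step.
pose fix a n := if n is p.+1 then f (p, a p) else (x0, 1 : R).
have aP n : D (a n).1 /\ 0 < (a n).2.
  elim: n => [|n [Dn n0]]; first by split.
  by have [] := fP (n, a n) Dn n0.
have aS n := fP (n, a n) (aP n).1 (aP n).2.
have nest n m : closed_ball (a (n + m).+1).1 (a (n + m).+1).2 `<=`
    closed_ball (a n.+1).1 (a n.+1).2.
  elim: m => [|m IH]; first by rewrite addn0.
  rewrite addnS; apply: subset_trans IH.
  have [_ _ _ + _] := aS (n + m).+1; move/subset_trans; apply.
  exact: subset_closure.
have inS n m : (n < m)%N -> closed_ball (a n.+1).1 (a n.+1).2 (a m).1.
  case: m => // m; rewrite ltnS => nm; rewrite -(subnKC nm); apply: nest.
  by apply: closed_ballxx; exact: (aP _).2.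
have small n : (a n).2 <= 2^-1 ^+ n.
  elim: n => [|n IH]; first by rewrite expr0.
  have [_ _ + _ _] := aS n; move=> /le_trans; apply.
  by rewrite exprSr ler_pM2r.
have : cvg ((fun n => (a n).1) @ \oo).
  apply: cauchy_cvg; apply: cauchy_exP => e e0.
  have : \forall n \near \oo, (2^-1 : R) ^+ n < e.
    have /cvgrPdist_lt/(_ e e0) : (GRing.exp (2^-1 : R)) @ \oo --> 0.
      by apply: cvg_expr; rewrite ger0_norm ?invr_ge0// invf_lt1// ltr1n.
    by apply: filterS => n; rewrite sub0r normrN ger0_norm// exprn_ge0// invr_ge0.
  move=> [N _ Ne]; exists (a N.+1).1, N.+1 => // m /= Nm.
  have := inS N m Nm; rewrite closed_ballE; last exact: (aP N.+1).2.
  rewrite -ball_normE /closed_ball_ /= => /le_lt_trans; apply.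
  apply: le_lt_trans (small N.+1) _.
  by apply: Ne => /=; exact: leqnSn.
rewrite cvg_ex => -[/= l al].
have lS n : closed_ball (a n.+1).1 (a n.+1).2 l.
  apply: (@closed_cvg _ _ \oo _ (fun n => (a n).1)) al => //.
    exact: closed_ball_closed.
  by exists n.+1 => // m /= /inS.
have Dl : D l.
  apply: (@closed_cvg _ _ \oo _ (fun n => (a n).1)) al => //.
  by apply: nearW => n; exact: (aP n).1.
have [n _ Bl] := DB l Dl.
by have [_ _ _ _ /(_ l (lS n))] := aS n; apply.
Qed.

Lemma finite_argmax (R : realType) (T : Type) (A : set T) (f : T -> R) :
  finite_set A -> A !=set0 -> exists2 a, A a & forall b, A b -> f b <= f a.
Proof.
move=> /finite_setP[n]; elim: n => [|n IH] in A *.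
  by rewrite II0 card_eq0 => /eqP -> [].
move=> /eq_cardSP[t At An] _.
have [/IH -/(_ An)[a [Aa _] amax]|A0] := pselect ((A `\ t) !=set0); last first.
  exists t => // b Ab; have [->//|/eqP bt] := eqVneq (b : {classic T}) t.
  by exfalso; apply: A0; exists b.
have [fat|fta] := leP (f a) (f t); [exists t|exists a] => // b Ab.
  have [->//|/eqP bt] := eqVneq (b : {classic T}) t.
  exact: le_trans (amax b _) fat.
have [->|/eqP bt] := eqVneq (b : {classic T}) t; first exact: ltW.
exact: amax.
Qed.

End general.

(** * Balls of c_0 in coordinates *)

Section c0_balls.
Context {R : realType} {Gamma : Type}.
Implicit Types (x y z : c0 R Gamma).

Lemma c0_norm_leP x r : 0 <= r -> `|x| <= r <-> forall g, `|x g| <= r.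
Proof.
move=> r0; split=> [xr g|]; last exact: c0_norm_le.
exact: le_trans (c0_le_norm x g) xr.
Qed.

Lemma c0_closed_ballP x r z : 0 < r ->
  closed_ball x r z <-> forall g, `|z g - x g| <= r.
Proof.
move=> r0; rewrite closed_ballE// /closed_ball_/= distrC.
exact: c0_norm_leP (ltW r0).
Qed.

Lemma c0_ball_coord x e z g : ball x e z -> `|z g - x g| < e.
Proof.
by rewrite -ball_normE /= distrC; exact: le_lt_trans (c0_le_norm (z - x) g).
Qed.

Lemma c0_ball_le x e z d : 0 <= d -> d < e -> (forall g, `|z g - x g| <= d) ->
  ball x e z.
Proof.
move=> d0 de zx; rewrite -ball_normE /= distrC; apply: le_lt_trans de.
exact/c0_norm_leP.
Qed.

End c0_balls.

Section c0_nat.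
Context {R : realType}.
Notation X := (c0 R nat).

Lemma splice_vanishing n (f : nat -> R) (x : X) :
  (fun i => if (i < n)%N then f i else x i) \in @vanishing_pred R nat.
Proof.
apply/vanishingP => e e0.
apply: (@sub_finite_set _ _ (`I_n `|` [set i | e <= `|x i|])).
  by move=> i /=; case: ifP => [|_]; [left|right].
by rewrite finite_setU; split; [exact: finite_II|exact: c0P].
Qed.

(** All auxiliary vectors of c_0(nat) are built this way: f need not vanish at
    infinity because x takes over. *)
Definition splice n (f : nat -> R) (x : X) : X := C0 (splice_vanishing n f x).

Lemma spliceE n f x i : splice n f x i = if (i < n)%N then f i else x i.
Proof. by []. Qed.

Lemma c0_tail (x : X) e : 0 < e ->
  \forall n \near \oo, forall i, (n <= i)%N -> `|x i| < e.
Proof.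
move=> e0; have /finite_seqP[s sE] := c0P x e0.
exists (\max_(j <- s) j).+1 => // n /= sn i ni; rewrite ltNge; apply/negP => ei.
have si : i \in s by have : [set` s] i by rewrite -sE.
have := leq_trans sn ni; apply/negP; rewrite -leqNgt.
by rewrite (big_rem _ si) leq_maxl.
Qed.

End c0_nat.

(** * Star-finite coverings by balls in separable c_0 *)

(** The centre and the radius are functions of the set, and F is a set of sets
    rather than of pairs, so that star-finiteness counts balls as sets. *)
Section star_finite_boxes.
Context {R : realType}.
Notation X := (c0 R nat).
Variables (F : set (set X)) (cen : set X -> X) (rad : set X -> R).
Hypothesis rad_gt0 : forall B, F B -> 0 < rad B.
Hypothesis memF : forall B z, F B ->
  B z <-> forall i, `|z i - cen B i| <= rad B.
Hypothesis coverF : forall z, exists2 B, F B & B z.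
Hypothesis sfF : star_finite F.

Lemma touch_finite B : F B -> finite_set [set C | F C /\ B `&` C !=set0].
Proof.
move=> FB; apply: (@sub_finite_set _ _
  ([set B] `|` [set C | [/\ F C, C <> B & B `&` C !=set0]])).
  move=> C [FC BC]; have [->|CB] := pselect (C = B); first by left.
  by right.
by rewrite finite_setU; split; [exact: finite_set1|exact: sfF].
Qed.

Lemma point_finite z : finite_set [set B | F B /\ B z].
Proof.
have [B FB Bz] := coverF z.
by apply: sub_finite_set (touch_finite FB) => C [FC Cz]; split=> //; exists z.
Qed.

(** The points near which small balls are superfluous. The same r bounds the
    neighbourhood and the radii, which makes the set of such points open by the
    triangle inequality alone. *)
Definition fat x := exists2 r : R, 0 < r &
  forall z, ball x r z -> exists B, [/\ F B, B z & r <= rad B].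

Lemma splice_ball n x d (z : X) : ball x d z -> ball x d (splice n z x).
Proof.
rewrite -[in X in X -> _]ball_normE /= => xzd.
apply: (c0_ball_le _ xzd) => // i; rewrite spliceE; case: ifP => _.
  by rewrite distrC; exact: (c0_le_norm (x - z) i).
by rewrite subrr normr0.
Qed.

(** Truncation makes the balls near x finite in number: once z agrees with x
    after coordinate N, a ball of radius at least r through z contains one of
    finitely many points that depend on x, N and r only. Coordinates beyond N
    can be restored because every ball through x has room for them. *)
Lemma fat_star x : fat x -> exists2 d : R, 0 < d &
  forall z, ball x d z -> exists B, [/\ F B, B x & B z].
Proof.
move=> [r r0 rP].
have [N] : exists N, forall B, F B /\ B x ->
    forall i, (N <= i)%N -> `|x i - cen B i| <= rad B / 2.
  suff /filter_ex : \forall n \near \oo, forall B, F B /\ B x ->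
    forall i, (n <= i)%N -> `|x i - cen B i| <= rad B / 2 by [].
  apply: near_finite (point_finite x) _ => B [FB _].
  have rB : 0 < rad B / 2 by rewrite divr_gt0 ?rad_gt0.
  by apply: filterS (c0_tail (x - cen B) rB) => n nP i /nP/ltW.
move=> NP.
pose p (s : N.-tuple bool) :=
  splice N (fun i => x i + if nth false s i then r / 2 else - (r / 2)) x.
have Qfin : finite_set [set B | F B /\ exists s, B (p s)].
  apply: (@sub_finite_set _ _
    (\bigcup_(s in [set: N.-tuple bool]) [set B | F B /\ B (p s)])).
    by move=> B [FB [s Bs]]; exists s.
  by apply: bigcup_finite => // s _; exact: point_finite.
have : \forall d \near 0^'+, [/\ 0 < d :> R, d <= r / 2,
    forall B, F B /\ B x -> d <= rad B / 2 &
    forall B, F B /\ (exists s, B (p s)) -> B x \/ forall z, ball x d z -> ~ B z].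
  have h1 : \forall d \near 0^'+, 0 < d :> R by exact: nbhs_right_gt.
  have h2 : \forall d \near 0^'+, d <= r / 2.
    by apply: nbhs_right_le; rewrite divr_gt0.
  have h3 : \forall d \near 0^'+, forall B, F B /\ B x -> d <= rad B / 2.
    apply: near_finite (point_finite x) _ => B [FB _].
    by apply: nbhs_right_le; rewrite divr_gt0 ?rad_gt0.
  have h4 : \forall d \near (0 : R)^'+, forall B, F B /\ (exists s, B (p s)) ->
      B x \/ forall z, ball x d z -> ~ B z.
    apply: near_finite Qfin _ => B [FB _].
    have [Bx|/(contra_not (memF x FB).2)/existsNP[i /negP]] := pselect (B x).
      by apply: nearW; left.
    rewrite -ltNge -subr_gt0 => xi.
    near=> d; right=> z /(@c0_ball_coord _ _ _ _ _ i) zx /(memF z FB)/(_ i) zB.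
    have : d <= `|x i - cen B i| - rad B.
      by near: d; apply: nbhs_right_le.
    have := ler_distD (z i) (x i) (cen B i).
    rewrite (distrC (x i) (z i)); lra.
  near=> d; split; near: d.
  - exact: h1.
  - exact: h2.
  - exact: h3.
  - exact: h4.
move=> nd.
have [d [d0 dr dT dQ]] := @filter_ex _ _ (at_right_proper_filter (0 : R)) _ nd.
exists d => // z xz.
have xz' := splice_ball N xz.
have [|C [FC Cz' rC]] := rP (splice N z x).
  by apply: le_ball xz'; lra.
have Cz'i i := (memF _ FC).1 Cz' i.
(* Moving x i by r / 2 towards the centre of C ends in C: if it passes the
   centre, then by at most r / 2; if it stops short of the centre, then it has
   moved past the i-th coordinate of a point of C, as d <= r / 2. *)
have Cp : exists s, C (p s).
  exists [tuple of mkseq (fun i => x i <= cen C i) N].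
  apply/(memF _ FC) => i; move: (Cz'i i); rewrite !spliceE /=; case: ifP => // iN.
  rewrite nth_mkseq//; have := c0_ball_coord i xz.
  rewrite ltr_distl => /andP[z1 z2]; rewrite !ler_distl => /andP[z3 z4].
  by have [xC|xC] := leP (x i) (cen C i); apply/andP; split; lra.
have Cx : C x by have [//|] := dQ C (conj FC Cp); move=> /(_ _ xz').
exists C; split=> //; apply/(memF _ FC) => i.
have [iN|iN] := ltnP i N; first by have := Cz'i i; rewrite spliceE iN.
have := NP C (conj FC Cx) i iN.
have := c0_ball_coord i xz; have := dT C (conj FC Cx).
have := ler_distD (x i) (z i) (cen C i); lra.
Unshelve. all: by end_near.
Qed.

(** A diagonal argument on faces: the balls touching C are finitely many, and
    each one that is not larger than C is defeated in a coordinate of its own.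
    Larger balls cannot interfere, because the chosen coordinates are so far out
    that a larger ball contains the whole range of C there. *)
Lemma fat_ball_not_maximal C z : F C -> C `<=` fat -> C z ->
  exists B, [/\ F B, B z & rad C < rad B].
Proof.
move=> FC Cfat Cz; apply: contrapT => nobig.
have Czi i := (memF z FC).1 Cz i.
have [N NP] : exists N, forall B, F B /\ C `&` B !=set0 -> rad C < rad B ->
    forall i, (N <= i)%N -> `|cen B i - cen C i| <= rad B - rad C.
  suff /filter_ex : \forall n \near \oo, forall B, F B /\ C `&` B !=set0 ->
    rad C < rad B ->
    forall i, (n <= i)%N -> `|cen B i - cen C i| <= rad B - rad C by [].
  apply: near_finite (touch_finite FC) _ => B [FB _].
  have [BC|BC] := leP (rad B) (rad C); first by apply: nearW.
  have rBC : 0 < rad B - rad C by rewrite subr_gt0.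
  by apply: filterS (c0_tail (cen B - cen C) rBC) => n nP _ i /nP/ltW.
have /finite_seqP[s sE] := touch_finite FC.
(* Coordinate N + k serves the k-th ball of s; the sign points away from the
   centre of that ball, and +1 is a harmless choice for equal centres. *)
pose sg i : R := if cen (nth C s (i - N)) i <= cen C i then 1 else -1.
pose y t := splice (N + size s)
  (fun i => if (i < N)%N then z i else cen C i + sg i * (rad C + t)) z.
have rC := rad_gt0 FC.
have sg1 i : `|sg i| = 1 by rewrite /sg; case: ifP => _; rewrite ?normrN normr1.
have Cy : C (y 0).
  apply/(memF _ FC) => i; rewrite spliceE; case: ifP => // _; case: ifP => // _.
  by rewrite addr0 addrAC subrr add0r normrM sg1 mul1r ger0_norm// ltW.
(* y 0 lies on faces of C, and y t leaves C through all these faces at once. *)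
have [d d0 dP] := fat_star (Cfat _ Cy).
have [|B [FB By0 By]] := dP (y (d / 2)).
  apply: (@c0_ball_le _ _ _ _ _ (d / 2)); [lra|lra|] => i.
  rewrite !spliceE; case: ifP => _; last by rewrite subrr normr0; lra.
  case: ifP => _; first by rewrite subrr normr0; lra.
  rewrite (_ : _ - _ = sg i * (d / 2)); last by lra.
  by rewrite normrM sg1 mul1r ger0_norm//; lra.
have TB : F B /\ C `&` B !=set0 by split=> //; exists (y 0).
have sB : B \in s by have : [set` s] B by rewrite -sE.
have [CB|BC] := ltP (rad C) (rad B).
  apply: nobig; exists B; split=> //; apply/(memF _ FB) => i.
  have [iN|iN] := ltnP i N.
    have := (memF _ FB).1 By0 i.
    by rewrite spliceE iN (leq_trans iN) ?leq_addr.
  have := NP B TB CB i iN; have := Czi i.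
  have := ler_distD (cen C i) (z i) (cen B i).
  by rewrite (distrC (cen C i)); lra.
have := (memF _ FB).1 By (N + index B s)%N.
rewrite spliceE ltn_add2l index_mem sB ltnNge leq_addr/=.
rewrite /sg addKn nth_index// ler_distl => /andP[].
by have [|] := leP (cen B (N + index B s)%N) (cen C (N + index B s)%N); lra.
Qed.

Lemma max_ball z :
  exists C, [/\ F C, C z & forall B, F B -> B z -> rad B <= rad C].
Proof.
have [|C [FC Cz] Cmax] := finite_argmax rad (point_finite z).
  by have [B FB Bz] := coverF z; exists B.
by exists C; split=> // B FB Bz; exact: Cmax.
Qed.

(** Otherwise all points of C would be fat, and z would lie in a larger ball. *)
Lemma max_ball_thin z C : F C -> C z ->
  (forall B, F B -> B z -> rad B <= rad C) -> exists2 y, C y & ~ fat y.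
Proof.
move=> FC Cz Cmax; apply: contrapT => nothin.
have [|B [FB Bz]] := fat_ball_not_maximal FC _ Cz; last by rewrite ltNge Cmax.
by move=> y Cy; apply: contrapT => nfat; apply: nothin; exists y.
Qed.

Lemma closed_thin : closed [set x | ~ fat x].
Proof.
rewrite -[X in closed X]/(~` [set x | fat x]) closedC openE => x [r r0 rP].
apply/nbhs_ballP; exists (r / 2) => /=; first by rewrite divr_gt0.
move=> y xy; exists (r / 2); first by rewrite divr_gt0.
move=> z yz; have [|B [FB Bz rB]] := rP z; last by exists B; split=> //; lra.
by rewrite [r]splitr; exact: ball_triangle xy yz.
Qed.

(** Each ball contains one of the countably many finitely supported rational
    vectors, and each such vector lies in finitely many balls. *)
Lemma countable_boxes : countable F.
Proof.
pose pt (s : seq rat) : X := splice (size s) (fun i => ratr (nth 0 s i)) 0.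
apply: (@sub_countable _ _ _
  (\bigcup_(s in [set: seq rat]) [set B | F B /\ B (pt s)])).
  apply: subset_card_le => B FB; have rB := rad_gt0 FB.
  have [n _ nP] := c0_tail (cen B) rB.
  have q i : exists q : rat, `|ratr q - cen B i| <= rad B.
    have [|q] := @rat_in_itvoo R (cen B i - rad B) (cen B i + rad B); first by lra.
    rewrite in_itv /= => /andP[q1 q2].
    by exists q; rewrite ler_distl !ltW.
  have [f fP] := choice q; exists (mkseq f n) => //; split=> //.
  apply/(memF _ FB) => i; rewrite spliceE size_mkseq; case: ltnP => ni.
    by rewrite nth_mkseq.
  by rewrite sub0r normrN ltW//; exact: (nP n (leqnn n)).
apply: bigcup_countable => // s _; apply: finite_set_countable.
exact: point_finite.
Qed.

(** Baire's theorem gives a thin point x near which one ball f n contains all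
    thin points; maximal balls near x are then large or touch f n, so x would
    be fat. *)
Lemma no_star_finite_boxes : False.
Proof.
have [F0|/surjfunPex[f FE]] := pfcard_geP countable_boxes.
  by have [B] := coverF 0; rewrite F0.
have Ff n : F (f n) by rewrite FE; exists n.
have box_closed B : F B -> closed B.
  move=> FB; rewrite (_ : B = closed_ball (cen B) (rad B)).
    exact: closed_ball_closed.
  apply/seteqP; split=> z.
    by move/(memF _ FB)/(c0_closed_ballP _ _ (rad_gt0 FB)).
  by move/(c0_closed_ballP _ _ (rad_gt0 FB))/(memF _ FB).
have thin0 : [set x | ~ fat x] !=set0.
  have [C [FC C0 Cmax]] := max_ball 0.
  by have [y _ nfat] := max_ball_thin FC C0 Cmax; exists y.
have [] := baire_closed closed_thin thin0 (fun n => box_closed _ (Ff n)).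
  move=> x _; have [B FB Bx] := coverF x.
  by move: FB; rewrite FE => -[n _ fB]; exists n => //; rewrite fB.
move=> n [x [e [thinx e0 xeB]]].
have : \forall d \near 0^'+, [/\ 0 < d :> R, d <= e / 4 &
    forall C, F C /\ f n `&` C !=set0 -> d <= rad C].
  have h1 : \forall d \near 0^'+, 0 < d :> R by exact: nbhs_right_gt.
  have h2 : \forall d \near 0^'+, d <= e / 4.
    by apply: nbhs_right_le; rewrite divr_gt0.
  have h3 : \forall d \near 0^'+, forall C, F C /\ f n `&` C !=set0 -> d <= rad C.
    apply: near_finite (touch_finite (Ff n)) _ => B [FB _].
    by apply: nbhs_right_le; exact: rad_gt0.
  near=> d; split; near: d.
  - exact: h1.
  - exact: h2.
  - exact: h3.
move=> nd.
have [d [d0 de dn]] := @filter_ex _ _ (at_right_proper_filter (0 : R)) _ nd.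
apply: thinx; exists d => // z xz.
have [C [FC Cz Cmax]] := max_ball z; exists C; split=> //.
rewrite leNgt; apply/negP => Cd.
have [y Cy thiny] := max_ball_thin FC Cz Cmax.
(* z is within d of x and y within 2 * d of z, as both y and z are in C. *)
have : (f n) y.
  apply: xeB; split=> //.
  apply: (@c0_ball_le _ _ _ _ _ (3 * d)); [lra|lra|] => i.
  have := (memF _ FC).1 Cy i; have := (memF _ FC).1 Cz i.
  rewrite (distrC (z i)).
  have := ler_distD (z i) (y i) (x i).
  have := ler_distD (cen C i) (y i) (z i).
  have := c0_ball_coord i xz.
  lra.
move=> ny; have : d <= rad C by apply: dn; split=> //; exists y.
by rewrite leNgt Cd.
Unshelve. all: by end_near.
Qed.

End star_finite_boxes.

(** * Countably many coordinates of c_0(Gamma) *)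

Section countable_coordinates.
Context {R : realType} {Gamma : Type}.
Variable u : nat -> Gamma.
Hypothesis u_inj : injective u.

Lemma restrict_vanishing (c : c0 R Gamma) : (c \o u) \in @vanishing_pred R nat.
Proof.
apply/vanishingP => e e0; apply: (@finite_preimage _ _ _ u) (c0P c e0).
by move=> i j _ _; exact: u_inj.
Qed.

Definition restrict (c : c0 R Gamma) : c0 R nat := C0 (restrict_vanishing c).

(** The index chosen is unique because u is injective. *)
Definition extend_fun (f : nat -> R) (g : Gamma) : R :=
  if pselect (exists i, u i = g) is left ug then f (sval (cid ug)) else 0.

Lemma extend_funE f i : extend_fun f (u i) = f i.
Proof.
rewrite /extend_fun; case: pselect => [ui|[]]; last by exists i.
by congr f; apply: u_inj; exact: svalP (cid ui).
Qed.

Lemma extend_fun_out f g : ~ (exists i, u i = g) -> extend_fun f g = 0.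
Proof. by rewrite /extend_fun; case: pselect. Qed.

Lemma extend_vanishing (f : c0 R nat) : extend_fun f \in @vanishing_pred R Gamma.
Proof.
apply/vanishingP => e e0; apply: sub_finite_set (finite_image u (c0P f e0)).
move=> g /=; have [[i <-]|nug] := pselect (exists i, u i = g).
  by rewrite extend_funE => ei; exists i.
by rewrite extend_fun_out// normr0 leNgt e0.
Qed.

Definition extend (f : c0 R nat) : c0 R Gamma := C0 (extend_vanishing f).

Lemma extendE f i : extend f (u i) = f i.
Proof. exact: extend_funE. Qed.

Lemma extend_out f g : ~ (exists i, u i = g) -> extend f g = 0.
Proof. exact: extend_fun_out. Qed.

Lemma extend_closed_ballP c r f : 0 < r ->
  closed_ball c r (extend f) <->
    (forall i, `|f i - restrict c i| <= r) /\
    (forall g, ~ (exists i, u i = g) -> `|c g| <= r).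
Proof.
move=> r0; rewrite c0_closed_ballP//; split=> [cf|[cf cout] g].
  split=> [i|g nug]; first by have := cf (u i); rewrite extendE.
  by have := cf g; rewrite extend_out// sub0r normrN.
have [[i <-]|nug] := pselect (exists i, u i = g).
  by rewrite extendE; exact: cf.
by rewrite extend_out// sub0r normrN; exact: cout.
Qed.

(** Intersecting with the vectors supported on the range of u gives a covering of
    c_0(nat). Distinct traces come from distinct balls, so star-finiteness
    passes to the traces, and a nonempty trace has the radius of the ball. *)
Lemma no_star_finite_ball_covering (F : set (set (c0 R Gamma))) :
  F `<=` closed_balls (c0 R Gamma) -> is_covering F -> star_finite F -> False.
Proof.
move=> Fball [_ Fcov] Fsf.
pose tr B := [set f | B (extend f)].
pose F' := [set B' | B' !=set0 /\ exists2 B, F B & B' = tr B].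
have box B' : exists p : c0 R nat * R, F' B' ->
    0 < p.2 /\ forall z, B' z <-> forall i, `|z i - p.1 i| <= p.2.
  have [[[f B'f] [B FB B'E]]|nF'] := pselect (F' B'); last by exists (0, 1).
  have [c [r r0 BE]] := Fball B FB; exists (restrict c, r) => _; split=> //= z.
  move: B'f; rewrite B'E BE /tr /= !extend_closed_ballP// => -[_ cout].
  by split=> [[]|zc].
have [p pP] := choice box.
apply: (@no_star_finite_boxes R F' (fst \o p) (snd \o p)).
- by move=> B' F'B'; exact: (pP B' F'B').1.
- by move=> B' z F'B'; exact: (pP B' F'B').2.
- move=> z; have : [set: c0 R Gamma] (extend z) by [].
  rewrite -Fcov => -[B FB Bz]; exists (tr B) => //; split; first by exists z.
  by exists B.
- move=> B' [_ [B FB B'E]].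
  apply: sub_finite_set (finite_image tr (Fsf B FB)).
  move=> C' [[_ [C FC C'E]] C'B' [f [B'f C'f]]]; exists C => //; split=> //.
    by move=> CB; apply: C'B'; rewrite C'E CB B'E.
  by exists (extend f); move: B'f C'f; rewrite B'E C'E.
Qed.

(** * Disjoint unit balls accumulating at a unit vector *)

Definition peak : c0 R Gamma := extend (splice 1 (fun=> 1) 0).

(** The coordinates 1, ..., n are negative and coordinate n + 1 is positive, so
    that coordinate n + 1 separates the n-th vector from all later ones. *)
Definition cluster_center (e : R) n : c0 R Gamma :=
  extend (splice n.+2 (fun i => if i == 0%N then 2 + e else
                                if i == n.+1 then 1 + e else - (1 + e)) 0).

Lemma peak_unit : unit_sphere peak.
Proof.
apply/eqP; rewrite eq_le; apply/andP; split.
  apply/c0_norm_leP => // g; have [[i <-]|nug] := pselect (exists i, u i = g).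
    rewrite /peak extendE spliceE; case: ifP => _; first by rewrite normr1.
    by rewrite normr0.
  by rewrite /peak extend_out// normr0.
by have := c0_le_norm peak (u 0%N); rewrite /peak extendE spliceE/= normr1.
Qed.

Lemma cluster_center_peak (e : R) n g : 0 < e ->
  `|cluster_center e n g - peak g| <= 1 + e.
Proof.
move=> e0; have [[i <-]|nug] := pselect (exists i, u i = g); last first.
  by rewrite /cluster_center /peak !extend_out// subrr normr0; lra.
rewrite /cluster_center /peak !extendE !spliceE; case: i => [|i] /=.
  by rewrite ger0_norm; lra.
rewrite ltnS; case: ifP => _; last by rewrite subrr normr0; lra.
by case: ifP => _; rewrite subr0 ?normrN ger0_norm; lra.
Qed.

Lemma cluster_balls_disjoint (e : R) n m w : 0 < e -> (n < m)%N ->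
  closed_ball (cluster_center e n) 1 w ->
  closed_ball (cluster_center e m) 1 w -> False.
Proof.
move=> e0 nm /c0_closed_ballP-/(_ ltr01 (u n.+1)) +
  /c0_closed_ballP-/(_ ltr01 (u n.+1)).
rewrite /cluster_center !extendE !spliceE /= !ltnS leqnn ltnW// eqxx eqSS ltn_eqF//.
rewrite !ler_distl => /andP[? ?] /andP[? ?]; lra.
Qed.

Lemma cluster_ball_unit_ball (e : R) n : 0 < e ->
  closed_ball (cluster_center e n) 1 `&` @unit_ball R (c0 R Gamma) = set0.
Proof.
move=> e0; apply/seteqP; split=> // w [].
move=> /c0_closed_ballP-/(_ ltr01 (u 0)) + /c0_closed_ballP-/(_ ltr01 (u 0)).
rewrite /cluster_center extendE spliceE /= subr0 ler_distl ler_norml.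
by move=> /andP[? ?] /andP[? ?]; lra.
Qed.

(** The vector p below is on the segment from peak to the centre, at distance at
    most 1 from the centre because that segment has length at most 1 + e. *)
Lemma edist_inf_cluster_ball (e : R) n : 0 < e ->
  (edist_inf (closed_ball (cluster_center e n) 1) peak <= e%:E)%E.
Proof.
move=> e0; have e1 : 0 < 1 + e by rewrite addr_gt0.
pose p := peak + (e / (1 + e)) *: (cluster_center e n - peak).
have pB : closed_ball (cluster_center e n) 1 p.
  apply/c0_closed_ballP => // g.
  have -> : p g - cluster_center e n g =
      - ((1 + e)^-1 * (cluster_center e n g - peak g)).
    have -> : p g = peak g + e / (1 + e) * (cluster_center e n g - peak g) by [].
    by field; rewrite gt_eqF.
  rewrite normrN normrM gtr0_norm ?invr_gt0// ler_pdivrMl// mulr1.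
  exact: cluster_center_peak.
apply: (@le_trans _ _ (edist (peak, p))).
  by apply: ereal_inf_lbound; exists p.
rewrite edist_norm lee_fin; apply/c0_norm_leP; first exact: ltW.
move=> g; have -> : (peak - p) g = - (e / (1 + e) * (cluster_center e n g - peak g)).
  have -> : (peak - p) g =
      peak g - (peak g + e / (1 + e) * (cluster_center e n g - peak g)) by [].
  by ring.
rewrite normrN normrM gtr0_norm ?divr_gt0// -[leRHS](@divfK _ (1 + e)) ?gt_eqF//.
by rewrite ler_pM2l ?divr_gt0// cluster_center_peak.
Qed.

Lemma not_property_I : ~ property_I (c0 R Gamma) nat.
Proof.
move=> /(_ peak peak_unit)[e e0 eP].
pose b n := closed_ball (cluster_center e n) 1.
have b_inj n m : b n `&` b m !=set0 -> n = m.
  move=> [w [nw mw]]; have [nm|mn|//] := ltngtP n m.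
    by case: (cluster_balls_disjoint e0 nm nw mw).
  by case: (cluster_balls_disjoint e0 mn mw nw).
have : (e%:E < ereal_sup [set edist_inf B peak | B in range b])%E.
  apply: eP.
  - by move=> _ [n _ <-]; exists (cluster_center e n).
  - by move=> _ [n _ <-]; exact: cluster_ball_unit_ball.
  - by move=> _ _ [n _ <-] [m _ <-] /b_inj ->.
  - apply: inj_card_eq => n m _ _ bnm; apply: b_inj; rewrite -bnm setIid.
    by exists (cluster_center e n); exact: closed_ballxx.
apply/negP; rewrite -leNgt; apply: ge_ereal_sup => _ [_ [n _ <-] <-].
exact: edist_inf_cluster_ball.
Qed.

End countable_coordinates.

Lemma infinite_injection (T : Type) : infinite_set [set: T] ->
  exists u : nat -> T, injective u.
Proof.
move=> /infiniteP/pcard_geP/surjPex[s sE].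
have /choice[u uP] : forall i, exists t, s t = i.
  by move=> i; have [t _ <-] : (s @` setT) i; [exact: sE|exists t].
by exists u => i j uij; rewrite -(uP i) uij uP.
Qed.

Theorem theorem3p16 (R : realType) (Gamma : Type) :
  infinite_set [set: Gamma] ->
  (~ exists F : set (set (c0 R Gamma)),
       [/\ F `<=` closed_balls (c0 R Gamma), is_covering F & star_finite F]) /\
  ~ property_I (c0 R Gamma) nat.
Proof.
move=> /infinite_injection[u u_inj]; split.
  move=> [F [Fball Fcov Fsf]].
  exact: (no_star_finite_ball_covering u_inj Fball Fcov Fsf).
exact: (not_property_I u_inj).
Qed.
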